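(* There exists a constant $c$ such that, for every positive integer $r$, $$HJ(3,r) \leq 2^{2^{cr}},$$ where $HJ(3,r)$ denotes the smallest positive integer $n$ such that every $r$-colouring of $[3]^n$ contains a monochromatic combinatorial line.
   Context: For a positive integer $m$, write $[m] = \{1,2,\dots,m\}$. A subset $L$ of $[m]^n$ is a combinatorial line if there is a non-empty set $I \subseteq [n]$ and elements $a_i \in [m]$ for each $i \in [n]\setminus I$ such that $$L = \{(x_1,\dots,x_n) \in [m]^n : x_i = a_i \text{ for all } i \notin I \text{ and } x_i = x_j \text{ for all } i,j \in I\}.$$ An $r$-colouring of $[m]^n$ is a function from $[m]^n$ to a set of $r$ colours, and a combinatorial line is monochromatic if all of its points receive the same colour. For positive integers $m$ and $r$, $HJ(m,r)$ is the smallest positive integer $n$ such that every $r$-colouring of $[m]^n$ contains a monochromatic combinatorial line (such an $n$ exists by the Hales--Jewett theorem). The constant $c$ is an absolute real constant, independent of $r$. *)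

(* Defs.v *)
From mathcomp Require Import all_boot.

Set Implicit Arguments.
Unset Strict Implicit.
Unset Printing Implicit Defensive.

(* Points of [m]^n: the alphabet [m] = {1, ..., m} and the coordinate set
   [n] = {1, ..., n} are both shifted to start at 0. *)
Definition point (m n : nat) : finType := {ffun 'I_n -> 'I_m}.

(* The fixed letters are given by a total function [a]; its values at the
   active coordinates [I] are not used. *)
Definition line_of (m n : nat) (I : {set 'I_n}) (a : 'I_n -> 'I_m) :
    {set point m n} :=
  [set x : point m n | [forall i, (i \notin I) ==> (x i == a i)]
                    && [forall i in I, forall j in I, x i == x j]].

Definition combinatorial_line (m n : nat) (L : {set point m n}) : Prop :=
  exists (I : {set 'I_n}) (a : 'I_n -> 'I_m), I != set0 /\ L = line_of I a.

Definition monochromatic (m n r : nat) (col : point m n -> 'I_r)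
    (L : {set point m n}) : Prop :=
  {in L &, forall x y, col x = col y}.

Definition HJ_property (m r n : nat) : Prop :=
  forall col : point m n -> 'I_r,
    exists L : {set point m n}, combinatorial_line L /\ monochromatic col L.

(* The graph of the Hales-Jewett function: [is_HJ m r n] means HJ(m, r) = n. *)
Definition is_HJ (m r n : nat) : Prop :=
  [/\ 0 < n, HJ_property m r n
    & forall k, 0 < k -> HJ_property m r k -> n <= k].

(* Main.v *)
Require Import Defs.
From mathcomp Require Import all_boot all_order all_algebra.
From mathcomp Require Import reals exp.
From mathcomp Require Import boolp zify.

Set Implicit Arguments.
Unset Strict Implicit.
Unset Printing Implicit Defensive.

(** The letters 1, 2, 3 of the alphabet are written 0, 1, 2.  Cut the
    coordinates into [r] consecutive blocks and, in each block of length K, only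
    use the K words 1^j 0^(K-j).  If a set of words has density 1/M in this grid
    and c is its most popular colour, then for K = 2rM two values j < j' of the
    first block both give colour c for a proportion at least 1/K^2 of the
    continuations.  Freeze the first block to the template 1^j * 0^(K-j'), where
    the j'-j stars are active, and keep these continuations.  For every earlier
    block s, the template that fills the stars of the blocks before s with 2 and
    leaves the other stars active has colour c_s at the letters 0 and 1, for all
    remaining continuations.  So if the popular colour of the words with all
    stars filled with 2 is some c_s, a monochromatic line appears, and this must
    happen after [r] blocks.  The density goes from 1/M to 1/(2rM)^2, whence the
    double exponential bound. *)

(** * Templates, with [None] as a star, and their lines *)

Definition fill (m : nat) (a : 'I_m) (w : seq (option 'I_m)) : seq 'I_m :=
  [seq odflt a x | x <- w].

Lemma fill_cat (m : nat) (a : 'I_m) u v : fill a (u ++ v) = fill a u ++ fill a v.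
Proof. exact: map_cat. Qed.

Lemma size_fill (m : nat) (a : 'I_m) w : size (fill a w) = size w.
Proof. exact: size_map. Qed.

Lemma fill_some (m : nat) (a : 'I_m) s : fill a (map Some s) = s.
Proof. by rewrite /fill -map_comp map_id. Qed.

Lemma fill_nseq (m : nat) (a : 'I_m) k x : fill a (nseq k x) = nseq k (odflt a x).
Proof. exact: map_nseq. Qed.

Definition point_of (m n : nat) (s : seq 'I_m.+1) : point m.+1 n :=
  [ffun i : 'I_n => nth ord0 s i].

Lemma template_line (m n r : nat) (col : point m.+1 n -> 'I_r)
    (w : seq (option 'I_m.+1)) :
  size w = n -> None \in w ->
  (forall a b, col (point_of n (fill a w)) = col (point_of n (fill b w))) ->
  exists L, combinatorial_line L /\ monochromatic col L.
Proof.
move=> szw Nw mono; set x0 := Some (@ord0 m).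
have ltNw : index None w < n by rewrite -szw index_mem.
pose i0 := Ordinal ltNw.
pose I := [set i : 'I_n | nth x0 w i == None].
have i0I : i0 \in I by rewrite inE /= nth_index.
pose a (i : 'I_n) := odflt ord0 (nth x0 w i).
exists (line_of I a); split.
  by exists I, a; split=> //; apply/set0Pn; exists i0.
(* Active coordinates agree, so their common letter can be read off at [i0]. *)
suff lineE x : x \in line_of I a -> x = point_of n (fill (x i0) w).
  by move=> x y /lineE -> /lineE ->.
rewrite inE => /andP[/forallP fixed /forall_inP act].
apply/ffunP => i; rewrite ffunE (nth_map x0) ?szw //.
have [iI|iI] := boolP (i \in I).
  have /forall_inP/(_ _ i0I)/eqP -> := act i iI.
  by move: iI; rewrite inE => /eqP ->.
have := fixed i; rewrite iI /= => /eqP ->.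
by move: iI; rewrite inE /a; case: nth.
Qed.

(** If [b] holds at N places, the right-hand side is 1 + N(N-1)/2, which is at least N. *)
Lemma count_leq_pairs (b : pred nat) K :
  \sum_(j < K) b j <= 1 + \sum_(j' < K) \sum_(j < j') (b j && b j').
Proof.
elim: K => [|K IHK]; first by rewrite !big_ord0.
rewrite !big_ord_recr /=; case: (b K); last first.
  by rewrite addn0 (leq_trans IHK)// leq_add2l leq_addr.
under [X in _ + (_ + X)]eq_bigr do rewrite andbT.
case: (posnP (\sum_(j < K) b j)) => [->|]; lia.
Qed.

(** Summing [count_leq_pairs] over [Y] gives at least [size Y] hits in total for the pairs [j < j'];
    there are fewer than [K ^ 2] pairs, so one is hit often. *)
Lemma popular_pair (T : Type) (B : nat -> pred T) (Y : seq T) K :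
  1 < K -> 2 * size Y <= \sum_(j < K) count (B j) Y ->
  exists j j', [/\ j < j', j' < K &
    size Y <= K ^ 2 * count (fun y => B j y && B j' y) Y].
Proof.
move=> K1 leY.
pose N (j j' : nat) := count (fun y => B j y && B j' y) Y.
have count_sum (P : pred T) : count P Y = \sum_(y <- Y) P y.
  by rewrite -sum1_count big_mkcond.
have lepairs : size Y <= \sum_(j' < K) \sum_(j < j') N j j'.
  have : \sum_(j < K) count (B j) Y <=
         size Y + \sum_(j' < K) \sum_(j < j') N j j'.
    under eq_bigr do rewrite count_sum.
    under [X in _ <= _ + X]eq_bigr => j' _ do
      (under eq_bigr do rewrite /N count_sum; rewrite exchange_big/=).
    rewrite exchange_big [X in _ <= _ + X]exchange_big /=.
    rewrite -sum1_size -big_split /=; apply: leq_sum => y _.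
    exact: (count_leq_pairs (fun j => B j y)).
  lia.
have [/existsP[j' /existsP[j ltY]]|none] :=
  boolP [exists j' : 'I_K, exists j : 'I_j', size Y <= K ^ 2 * N j j'].
  by exists j, j'.
(* An empty [Y] would meet the bound at the pair 0 < 1, available as [1 < K]. *)
have lt0Y : 0 < size Y.
  move: none; rewrite negb_exists => /forallP/(_ (Ordinal K1)).
  by rewrite negb_exists => /forallP/(_ ord0); case: (size Y).
suff : K ^ 2 * (\sum_(j' < K) \sum_(j < j') N j j') <= K ^ 2 * (size Y).-1.
  by rewrite leq_pmul2l ?expn_gt0; lia.
rewrite big_distrr /=.
have -> : K ^ 2 * (size Y).-1 = \sum_(j' < K) K * (size Y).-1.
  by rewrite sum_nat_const card_ord; lia.
apply: leq_sum => j' _; rewrite big_distrr /=.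
apply: (@leq_trans (\sum_(j < j') (size Y).-1)).
  apply: leq_sum => j _.
  move: none; rewrite negb_exists => /forallP/(_ j').
  by rewrite negb_exists => /forallP/(_ j); lia.
by rewrite sum_nat_const card_ord leq_mul2r ltnW ?orbT.
Qed.

Lemma popular_colour (T : Type) (r : nat) (A : pred T) (g : T -> 'I_r) (Y : seq T) :
  0 < r -> exists c, count A Y <= r * count (fun y => A y && (g y == c)) Y.
Proof.
case: r g => // r g _.
pose N c := count (fun y => A y && (g y == c)) Y.
have -> : count A Y = \sum_c N c.
  rewrite -sum1_count big_mkcond /=.
  under [RHS]eq_bigr do rewrite /N -sum1_count big_mkcond /=.
  rewrite exchange_big /=; apply: eq_bigr => y _.
  rewrite (bigD1 (g y)) //= eqxx andbT big1 ?addn0 // => c /negPf.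
  by rewrite eq_sym => ->; rewrite andbF.
have [c _ maxc] := @arg_maxnP _ ord0 predT N isT.
exists c; rewrite -/(N c).
have -> : r.+1 * N c = \sum_(i < r.+1) N c by rewrite sum_nat_const card_ord.
by apply: leq_sum => i _; apply: maxc.
Qed.

(** * The block-by-block construction *)

Section Grid.

Variable r : nat.

Let zero : 'I_3 := @Ordinal 3 0 isT.
Let one : 'I_3 := @Ordinal 3 1 isT.
Let two : 'I_3 := @Ordinal 3 2 isT.

Definition chain K j : seq 'I_3 := nseq j one ++ nseq (K - j) zero.

Lemma size_chain K j : j < K -> size (chain K j) = K.
Proof. by rewrite size_cat !size_nseq; lia. Qed.

Definition star K j j' : seq (option 'I_3) :=
  nseq j (Some one) ++ nseq (j' - j) None ++ nseq (K - j') (Some zero).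

Lemma star_active K j j' : j < j' -> None \in star K j j'.
Proof. by move=> ltj; rewrite !mem_cat (mem_nseq (j' - j)) subn_gt0 ltj eqxx orbT. Qed.

Lemma size_star K j j' : j < j' -> j' < K -> size (star K j j') = K.
Proof. by move=> ltj ltK; rewrite !size_cat !size_nseq; lia. Qed.

Lemma fill_star_zero K j j' : j < j' -> j' < K -> fill zero (star K j j') = chain K j.
Proof.
move=> ltj ltK; rewrite !fill_cat !fill_nseq /= -nseqD.
by congr (_ ++ nseq _ _); lia.
Qed.

Lemma fill_star_one K j j' : j < j' -> j' < K -> fill one (star K j j') = chain K j'.
Proof.
move=> ltj ltK; rewrite !fill_cat !fill_nseq /= catA -nseqD.
by congr (nseq _ _ ++ _); lia.
Qed.

(* [m] blocks, the first one of size [K]: if K = 2rM handles a set of density 1/M,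
   the next density 1/K^2 calls for a block of size 2rK^2. *)
Fixpoint grid m K : seq (seq 'I_3) :=
  if m is m'.+1 then
    [seq chain K j ++ y | j <- iota 0 K, y <- grid m' (2 * r * K ^ 2)]
  else [:: [::]].

Fixpoint grid_length m K : nat :=
  if m is m'.+1 then K + grid_length m' (2 * r * K ^ 2) else 0.

Lemma size_grid m K y : y \in grid m K -> size y = grid_length m K.
Proof.
elim: m K y => [|m IHm] K y /=; first by rewrite inE => /eqP ->.
case/allpairsP => -[j z] /= [].
by rewrite mem_iota => jK /IHm szz ->; rewrite size_cat szz size_chain.
Qed.

Lemma count_allpairs_cat (B : pred (seq 'I_3)) (Y : seq (seq 'I_3)) K :
  count B [seq chain K j ++ y | j <- iota 0 K, y <- Y] =
  \sum_(j < K) count (fun y => B (chain K j ++ y)) Y.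
Proof.
rewrite count_flatten sumnE !big_map -(big_mkord predT (fun j =>
  count (fun y => B (chain K j ++ y)) Y)) /index_iota subn0.
by apply: eq_bigr => j _; rewrite count_map.
Qed.

Lemma size_grid_gt0 m K : 0 < r -> 0 < K -> 0 < size (grid m K).
Proof.
move=> r0; elim: m K => //= m IHm K K0.
by rewrite size_allpairs size_iota muln_gt0 K0 IHm // !muln_gt0 r0 K0.
Qed.

Lemma I3_case (a : 'I_3) : [\/ a = zero, a = one | a = two].
Proof.
case: a => -[|[|[|//]]] lta; [constructor 1|constructor 2|constructor 3];
  exact: val_inj.
Qed.

(* [t] is an earlier template with its colour, [p] the frozen prefix with all stars
   filled with 2 (the same for all [t]), and [A] the set of continuations kept. *)
Definition good_template (f : seq 'I_3 -> 'I_r) (p : seq 'I_3) (A : pred (seq 'I_3))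
    (t : seq (option 'I_3) * 'I_r) : Prop :=
  [/\ None \in t.1, size t.1 = size p, fill two t.1 = p &
    forall y, A y -> f (fill zero t.1 ++ y) = t.2 /\ f (fill one t.1 ++ y) = t.2].

Lemma good_template_line f p A t y :
  good_template f p A t -> A y -> f (p ++ y) = t.2 ->
  exists w, [/\ None \in w, size w = size p + size y &
    forall a b, f (fill a w) = f (fill b w)].
Proof.
move=> [Nt szt ft2 /(_ y)ft] /ft[ft0 ft1] fp; exists (t.1 ++ map Some y); split.
- by rewrite mem_cat Nt.
- by rewrite size_cat size_map szt.
suff fc a : f (fill a (t.1 ++ map Some y)) = t.2 by move=> a b; rewrite !fc.
by rewrite fill_cat fill_some; case: (I3_case a) => ->; rewrite ?ft0 ?ft1 ?ft2.
Qed.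

(** Induction on the number [m] of blocks left: each block either yields a line or adds a new colour
    to [ts], so [size ts + m] stays equal to [r]. *)
Lemma grid_line (f : seq 'I_3 -> 'I_r) m M (p : seq 'I_3)
    (ts : seq (seq (option 'I_3) * 'I_r)) (A : pred (seq 'I_3)) :
    0 < M -> size (grid m (2 * r * M)) <= M * count A (grid m (2 * r * M)) ->
    uniq [seq t.2 | t <- ts] -> size ts + m = r ->
    {in ts, forall t, good_template f p A t} ->
  exists w, [/\ None \in w, size w = size p + grid_length m (2 * r * M) &
    forall a b, f (fill a w) = f (fill b w)].
Proof.
have r0 : 0 < r by case: r (f [::]) => [[]|].
elim: m M p ts A => [|m IHm] M p ts A M0; set K := 2 * r * M => dense uniqc szts tsP.
  have A0 : A [::] by move: dense => /=; case: (A [::]) => //; lia.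
  (* No block is left, so [ts] shows all [r] colours. *)
  have : f p \in [seq t.2 | t <- ts].
    have -> : [seq t.2 | t <- ts] =i predT; last by [].
    apply/subset_cardP; last exact/subsetP.
    by rewrite (card_uniqP uniqc) size_map card_ord; lia.
  case/mapP => t /tsP tP ft.
  by apply: (good_template_line (y := [::]) tP) => //; rewrite cats0.
have [c popc] := popular_colour A (fun y => f (p ++ y)) (grid m.+1 K) r0.
set B : pred (seq 'I_3) := fun y => A y && (f (p ++ y) == c) in popc.
have K0 : 0 < K by rewrite !muln_gt0 r0.
have leB : size (grid m.+1 K) <= M * r * count B (grid m.+1 K).
  by apply: leq_trans dense _; rewrite -mulnA leq_mul2l popc orbT.
(* An old colour closes a line: its template has it at letters 0 and 1, and any [y] in [B] gives it
   at letter 2. *)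
have [/mapP[t /tsP tP tc]|Nc] := boolP (c \in [seq t.2 | t <- ts]).
  have : has B (grid m.+1 K).
    rewrite has_count; have := size_grid_gt0 m.+1 r0 K0.
    by case: (count B _) leB => //; lia.
  case/hasP => y yG /andP[Ay /eqP fy]; rewrite -(size_grid yG).
  by apply: (good_template_line tP Ay); rewrite fy.
pose Y := grid m (2 * r * K ^ 2).
(* By the choice K = 2rM, a continuation has on average at least 2 good values of [j]. *)
have sumB : 2 * size Y <= \sum_(j < K) count (fun y => B (chain K j ++ y)) Y.
  move: leB; rewrite /= size_allpairs size_iota count_allpairs_cat -/Y.
  set S := \sum_(j < K) _ => leS.
  rewrite -(@leq_pmul2l (M * r)) ?muln_gt0 ?M0 //.
  by apply: leq_trans leS; rewrite /K; lia.
have K1 : 1 < K by rewrite /K; nia.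
have [j [j' [ltj ltK leY]]] :=
  popular_pair (B := fun j y => B (chain K j ++ y)) K1 sumB.
pose A' y := B (chain K j ++ y) && B (chain K j' ++ y).
(* The new template has stars in this block only, earlier ones being filled with 2; older templates
   extend their stars into it. *)
pose ts' := (map Some p ++ star K j j', c) ::
  [seq (t.1 ++ star K j j', t.2) | t <- ts].
have [| | | |w [Nw szw wP]] :=
    IHm (K ^ 2) (p ++ fill two (star K j j')) ts' A' _ leY.
- by rewrite expn_gt0 K0.
- by rewrite /= -map_comp Nc.
- by rewrite /= size_map; lia.
- move=> t; rewrite inE => /predU1P[->|/mapP[{}t tts ->]].
    split=> /=.
    + by rewrite mem_cat star_active ?orbT.
    + by rewrite size_cat size_map [RHS]size_cat size_fill.
    + by rewrite fill_cat fill_some.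
    move=> y /andP[/andP[_ /eqP fj] /andP[_ /eqP fj']].
    rewrite (fill_cat zero) (fill_cat one) !fill_some.
    by rewrite fill_star_zero // fill_star_one // -!(catA p).
  have [Nt szt ft2 ft] := tsP t tts.
  split=> /=.
  + by rewrite mem_cat Nt.
  + by rewrite size_cat szt [RHS]size_cat size_fill.
  + by rewrite fill_cat ft2.
  (* Old templates are applied to [chain K j ++ y] at letter 0 and to [chain K j' ++ y] at letter 1;
     both lie in [A]. *)
  move=> y /andP[/andP[/ft[fj _] _] /andP[/ft[_ fj'] _]].
  rewrite (fill_cat zero) (fill_cat one).
  by rewrite fill_star_zero // fill_star_one // -!(catA (fill _ t.1)).
exists w; split=> //.
by rewrite szw size_cat size_fill size_star //= addnA.
Qed.

Lemma HJ_property_grid : 0 < r -> HJ_property 3 r (grid_length r (2 * r)).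
Proof.
move=> r0 col; set n := grid_length r (2 * r).
have [||||w [Nw szw wP]] :=
    @grid_line (fun s => col (point_of n s)) r 1 [::] [::] predT isT.
- by rewrite count_predT mul1n.
- by [].
- by [].
- by [].
by apply: (template_line _ Nw wP); rewrite szw muln1.
Qed.

(** The next block has size at most [K ^ 3], and adding [K] costs at most one more factor [K]: hence
    the base 4. *)
Lemma grid_length_leq m K : 0 < r -> 2 * r <= K -> grid_length m K <= K ^ (4 ^ m).
Proof.
move=> r0; elim: m K => //= m IHm K leK.
have K0 : 0 < K by lia.
have leK3 : 2 * r * K ^ 2 <= K ^ 3 by rewrite expnS leq_mul2r leK orbT.
have leX : K <= K ^ (3 * 4 ^ m).
  by rewrite -{1}(expn1 K) leq_pexp2l // muln_gt0 expn_gt0.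
apply: (@leq_trans (K * K ^ (3 * 4 ^ m))); last first.
  rewrite -expnS leq_pexp2l // expnS.
  by have : 0 < 4 ^ m; [rewrite expn_gt0|lia].
apply: (@leq_trans (K + K ^ (3 * 4 ^ m))); last by nia.
rewrite leq_add2l (leq_trans (IHm _ _)) //; first by nia.
by rewrite expnM leq_exp2r // expn_gt0.
Qed.

(** Since [2 * r <= 2 ^ r] and [r < 2 ^ r], the length is at most 2^(r 4^r), hence at most 2^(8^r);
    the 3 comes from 8 = 2^3. *)
Lemma grid_length_bound : 0 < r -> grid_length r (2 * r) <= 2 ^ (2 ^ (3 * r)).
Proof.
move=> r0; apply: leq_trans (grid_length_leq r r0 (leqnn _)) _.
have ler : 2 * r <= 2 ^ r.
  case: r r0 => // k _; rewrite expnS leq_mul2l /=; exact: ltn_expl.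
apply: (@leq_trans ((2 ^ r) ^ (4 ^ r))); first by rewrite leq_exp2r // expn_gt0.
rewrite -expnM leq_exp2l // expnM -[2 ^ 3]/(2 * 4) expnMn leq_mul2r.
by rewrite ltnW ?orbT // ltn_expl.
Qed.

End Grid.

Lemma ex_HJ m r N : 0 < N -> HJ_property m r N -> exists n, is_HJ m r n /\ n <= N.
Proof.
move=> N0 HN; pose P n := (0 < n) && `[< HJ_property m r n >].
have exP : exists n, P n by exists N; rewrite /P N0; apply/asboolP.
case: (ex_minnP exP) => n /andP[n0 /asboolP Hn] minn.
exists n; split; last by apply: minn; rewrite /P N0; apply/asboolP.
by split=> // k k0 Hk; apply: minn; rewrite /P k0; apply/asboolP.
Qed.

Import GRing.Theory Num.Theory.

Local Open Scope ring_scope.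

Theorem theorem1 (R : realType) :
  exists c : R, forall r : nat, (0 < r)%N ->
    exists n : nat, is_HJ 3 r n /\ n%:R <= 2 `^ (2 `^ (c * r%:R)).
Proof.
exists 3%:R => r r0.
have len0 : (0 < grid_length r r (2 * r))%N by case: r r0 => //= k _; rewrite addn_gt0.
have [n [HJn len]] := ex_HJ len0 (HJ_property_grid r0).
exists n; split=> //.
rewrite -natrM powR_mulrn // -natrX powR_mulrn // -natrX ler_nat.
exact: leq_trans len (grid_length_bound r0).
Qed.
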